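(* Let $\mathbb{F}_q$ be a finite field of characteristic $p \neq 2$, let $f(x) \in \mathbb{F}_q[x]$ be an irreducible polynomial of degree $d$, and let $N : y^2 = x f(x)^2$ be the corresponding nodal curve over $\mathbb{F}_q$. Then any divisor class $D \in \mathrm{Jac}(N)$ is uniquely represented by a polynomial $h(x) \in \mathbb{F}_q[x]$ satisfying $$\deg(h(x)) < d \quad \text{and} \quad \gcd\big(f(x),\, x - h(x)^2\big) = 1,$$ where $h(x)$ represents the class given by the pair $[f(x)^2,\, h(x) f(x)]$.
   Context: $\mathrm{Jac}(N)$ denotes the (generalized) Jacobian of $N$, i.e. the ideal class group of its coordinate ring $\mathbb{F}_q[x,y]/(y^2 - x f(x)^2)$. Divisor classes on a curve $y^2 = F(x)$ are described by the extended Mumford representation: a pair of polynomials $[u(x), v(x)]$ represents a divisor class (the class of the ideal $(u(x), y - v(x))$) if (i) $\deg v < \deg u$; (ii) $u(x)$ divides $v(x)^2 - F(x)$; (iii) whenever $u(x)$ and $v(x)$ are both divisible by $x-a$ for a multiple root $a$ of $F(x)$ (a singular point $(a,0)$), the polynomial $(F(x) - v(x)^2)/u(x)$ is not divisible by $x-a$. The identity class is represented by $[1,0]$, and the group law on such pairs is computed by Cantor's algorithm.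
   Formalization: The claim is proved for every divisor class D other than the identity: the identity class [1,0] is represented by no such h, since the ideal (f², y − hf) is never principal; conversely every admissible h is shown to represent a non-identity class. *)

(* Defs.v *)
From HB Require Import structures.
From mathcomp Require Import all_boot all_order all_algebra all_field.
From mathcomp Require Import boolp classical_sets.

Set Implicit Arguments.
Unset Strict Implicit.
Unset Printing Implicit Defensive.

Import GRing.Theory.
Local Open Scope ring_scope.
Local Open Scope classical_set_scope.
Local Open Scope quotient_scope.

Section Ideals.
Context {R : comNzRingType}.
Implicit Types (I J K L : set R) (a b : R).

Definition is_ideal I :=
  [/\ I 0, forall x y, I x -> I y -> I (x + y) & forall a x, I x -> I (a * x)].

Definition ideal_gen (S : set R) : set R := smallest is_ideal S.

Definition ideal_mul I J : set R := ideal_gen [set x * y | x in I & y in J].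

Definition ideal_scale a I : set R := [set a * x | x in I].

(* Up to a regular scalar this is invertibility as a fractional ideal of the
   total ring of fractions: every invertible fractional ideal is a scalar
   multiple of such an [I], and [a^-1 J] is the inverse of [I].  *)
Definition is_invertible_ideal I :=
  is_ideal I /\
  exists J a, [/\ is_ideal J, GRing.lreg a & ideal_mul I J = ideal_scale a setT].

Definition ideal_equiv I J :=
  exists a b, [/\ GRing.lreg a, GRing.lreg b & ideal_scale a I = ideal_scale b J].

Lemma ideal_gen_ideal (S : set R) : is_ideal (ideal_gen S).
Proof.
split=> [A [[]]//|x y Hx Hy A hA|a x Hx A hA].
  by case: (hA) => -[_ h _] _; apply: h; [apply: Hx|apply: Hy].
by case: (hA) => -[_ _ h] _; apply: h; apply: Hx.
Qed.

Lemma setT_ideal : is_ideal (setT : set R).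
Proof. by []. Qed.

Lemma ideal_mul_sub I J K : is_ideal K ->
  ideal_mul I J `<=` K <-> (forall x y, I x -> J y -> K (x * y)).
Proof.
move=> hK; split=> [h x y Ix Jy|h].
  by apply: h; apply: sub_gen_smallest; exists x => //; exists y.
by apply: smallest_sub => // _ [x Ix [y Jy <-]]; apply: h.
Qed.

Lemma ideal_mul_mem I J x y : I x -> J y -> ideal_mul I J (x * y).
Proof. by move=> Ix Jy; apply: sub_gen_smallest; exists x => //; exists y. Qed.

Lemma ideal_mulC I J : ideal_mul I J = ideal_mul J I.
Proof.
by apply/seteqP; split; apply/ideal_mul_sub => [|x y Ix Jy];
  [exact: ideal_gen_ideal | rewrite mulrC; exact: ideal_mul_mem
  |exact: ideal_gen_ideal | rewrite mulrC; exact: ideal_mul_mem].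
Qed.

Lemma ideal_mulA_sub I J K :
  ideal_mul (ideal_mul I J) K `<=` ideal_mul I (ideal_mul J K).
Proof.
set L := ideal_mul I (ideal_mul J K); have hL : is_ideal L by exact: ideal_gen_ideal.
apply/ideal_mul_sub => // z c Hz Kc; pose M := [set z | L (z * c)].
suff: ideal_mul I J `<=` M by apply.
case: hL => L0 LD LM; apply/ideal_mul_sub => [|x y Ix Jy].
  split=> [|x y|a x]; rewrite /M /= ?mul0r// ?mulrDl -?mulrA; first exact: LD.
  exact: LM.
by rewrite /M /= -mulrA; do 2?apply: ideal_mul_mem.
Qed.

Lemma ideal_mulA I J K :
  ideal_mul I (ideal_mul J K) = ideal_mul (ideal_mul I J) K.
Proof.
apply/seteqP; split; last exact: ideal_mulA_sub.
rewrite (ideal_mulC I) (ideal_mulC I) (ideal_mulC J K) (ideal_mulC _ K).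
exact: ideal_mulA_sub.
Qed.

Lemma ideal_mulT I : is_ideal I -> ideal_mul setT I = I.
Proof.
move=> hI; apply/seteqP; split.
  by apply/ideal_mul_sub => // x y _ Iy; case: hI => _ _; apply.
by move=> x Ix; rewrite -[x]mul1r; apply: ideal_mul_mem.
Qed.

Lemma ideal_scale_ideal a I : is_ideal I -> is_ideal (ideal_scale a I).
Proof.
case=> I0 ID IM; split.
- by exists 0; rewrite ?mulr0.
- by move=> _ _ [x Ix <-] [y Iy <-]; exists (x + y); rewrite ?mulrDr //; exact: ID.
- by move=> c _ [x Ix <-]; exists (c * x); rewrite 1?mulrCA //; exact: IM.
Qed.

Lemma ideal_scale_mul a I J : is_ideal I ->
  ideal_scale a (ideal_mul I J) = ideal_mul (ideal_scale a I) J.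
Proof.
move=> hI; apply/seteqP; split; last first.
  apply/ideal_mul_sub; first exact/ideal_scale_ideal/ideal_gen_ideal.
  move=> _ y [x Ix <-] Jy; exists (x * y); last by rewrite mulrA.
  exact: ideal_mul_mem.
set L := ideal_mul (ideal_scale a I) J; have [L0 LD LM] : is_ideal L by exact: ideal_gen_ideal.
move=> _ [z Hz <-]; pose M := [set z | L (a * z)].
suff: ideal_mul I J `<=` M by apply.
apply/ideal_mul_sub => [|x y Ix Jy].
  split=> [|x y|c x]; rewrite /M /= ?mulr0// ?mulrDr; first exact: LD.
  by rewrite mulrCA; exact: LM.
by rewrite /M /= mulrA; apply: ideal_mul_mem => //; exists x.
Qed.

Lemma ideal_scaleM a b I : ideal_scale a (ideal_scale b I) = ideal_scale (a * b) I.
Proof.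
apply/seteqP; split=> [_ [_ [x Ix <-] <-]|_ [x Ix <-]].
  by exists x; rewrite ?mulrA.
by exists (b * x); [exists x|rewrite mulrA].
Qed.

Lemma ideal_scale_mul2 a b I J : is_ideal I -> is_ideal J ->
  ideal_mul (ideal_scale a I) (ideal_scale b J) =
  ideal_scale (a * b) (ideal_mul I J).
Proof.
move=> hI hJ; rewrite -ideal_scale_mul // ideal_mulC -ideal_scale_mul //.
by rewrite ideal_mulC ideal_scaleM.
Qed.

Lemma invertible_idealM I J : is_invertible_ideal I -> is_invertible_ideal J ->
  is_invertible_ideal (ideal_mul I J).
Proof.
move=> [hI [I' [a [hI' ra eI]]]] [hJ [J' [b [hJ' rb eJ]]]].
split; first exact: ideal_gen_ideal.
exists (ideal_mul I' J'), (a * b); split; first exact: ideal_gen_ideal.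
  exact: lregM.
rewrite ideal_mulA -(ideal_mulA I) (ideal_mulC J) (ideal_mulA I) -ideal_mulA.
by rewrite eI eJ ideal_scale_mul2 // ideal_mulT.
Qed.

Lemma invertible_idealT : is_invertible_ideal (setT : set R).
Proof.
split=> //; exists setT, 1; split=> //; first exact: lreg1.
rewrite ideal_mulT //; apply/seteqP; split=> // x _.
by exists x; rewrite ?mul1r.
Qed.

Lemma invertible_ideal_inv I : is_invertible_ideal I ->
  exists J, is_invertible_ideal J /\
    exists a, GRing.lreg a /\ ideal_mul I J = ideal_scale a setT.
Proof.
move=> [hI [J [a [hJ ra e]]]]; exists J; split; last by exists a.
by split=> //; exists I, a; rewrite ideal_mulC.
Qed.

Lemma ideal_equiv_refl I : ideal_equiv I I.
Proof. by exists 1, 1; split=> //; exact: lreg1. Qed.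

Lemma ideal_equiv_sym I J : ideal_equiv I J -> ideal_equiv J I.
Proof. by move=> [a [b [ra rb e]]]; exists b, a. Qed.

Lemma ideal_equiv_trans J I K :
  ideal_equiv I J -> ideal_equiv J K -> ideal_equiv I K.
Proof.
move=> [a [b [ra rb e]]] [c [d [rc rd e']]].
exists (c * a), (b * d); split; [exact: lregM|exact: lregM|].
by rewrite -ideal_scaleM e ideal_scaleM mulrC -!ideal_scaleM e'.
Qed.

Lemma ideal_equivM I I' J J' :
    is_ideal I -> is_ideal I' -> is_ideal J -> is_ideal J' ->
  ideal_equiv I I' -> ideal_equiv J J' ->
  ideal_equiv (ideal_mul I J) (ideal_mul I' J').
Proof.
move=> hI hI' hJ hJ' [a [b [ra rb e]]] [c [d [rc rd e']]].
exists (a * c), (b * d); split; [exact: lregM|exact: lregM|].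
by rewrite -!ideal_scale_mul2 // e e'.
Qed.

End Ideals.

Section ClassGroup.
Variable R : comNzRingType.

Definition invertible_ideal := {I : set R | `[< is_invertible_ideal I >]}.
HB.instance Definition _ := Choice.on invertible_ideal.
HB.instance Definition _ := SubType.on invertible_ideal.

Implicit Types I J : invertible_ideal.

Lemma invertible_idealP I : is_invertible_ideal (val I).
Proof. exact/asboolP/(valP I). Qed.

Lemma invertible_ideal_ideal I : is_ideal (val I).
Proof. by case: (invertible_idealP I). Qed.
Hint Resolve invertible_ideal_ideal : core.

Definition InvertibleIdeal (I : set R) (h : is_invertible_ideal I) :
  invertible_ideal := exist _ I (introT (asboolP _) h).

Definition class_rel I J := `[< ideal_equiv (val I) (val J) >].

Lemma class_rel_refl : reflexive class_rel.
Proof. by move=> I; apply/asboolP/ideal_equiv_refl. Qed.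
Lemma class_rel_sym : symmetric class_rel.
Proof. by move=> I J; apply/asboolP/asboolP; exact: ideal_equiv_sym. Qed.
Lemma class_rel_trans : transitive class_rel.
Proof.
by move=> J I K /asboolP h /asboolP h'; apply/asboolP/(ideal_equiv_trans h h').
Qed.

Canonical class_equiv :=
  EquivRel class_rel class_rel_refl class_rel_sym class_rel_trans.

Definition class_group := {eq_quot class_equiv}.
HB.instance Definition _ : EqQuotient _ class_equiv class_group :=
  EqQuotient.on class_group.
HB.instance Definition _ := Choice.on class_group.

Definition ideal_class : invertible_ideal -> class_group := \pi_class_group.

Lemma ideal_classE I J :
  ideal_class I = ideal_class J <-> ideal_equiv (val I) (val J).
Proof.
split=> [/eqquotP/asboolP //|h].
by apply/eqquotP/asboolP.
Qed.

Definition class0 : class_group := ideal_class (InvertibleIdeal invertible_idealT).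

Definition mul_invertible I J : invertible_ideal :=
  InvertibleIdeal (invertible_idealM (invertible_idealP I) (invertible_idealP J)).

Definition inv_invertible I : invertible_ideal :=
  let h := cid (invertible_ideal_inv (invertible_idealP I)) in
  InvertibleIdeal (proj1 (projT2 h)).

Lemma inv_invertibleP I : exists a,
  GRing.lreg a /\ ideal_mul (val I) (val (inv_invertible I)) = ideal_scale a setT.
Proof. by rewrite /inv_invertible /=; case: cid => J [hJ]. Qed.

Definition class_add (D E : class_group) : class_group :=
  ideal_class (mul_invertible (repr D) (repr E)).

Definition class_opp (D : class_group) : class_group :=
  ideal_class (inv_invertible (repr D)).

Lemma ideal_class_repr D : ideal_class (repr D) = D.
Proof. exact: reprK. Qed.

Lemma ideal_class_add I J :
  class_add (ideal_class I) (ideal_class J) = ideal_class (mul_invertible I J).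
Proof.
by apply/ideal_classE/ideal_equivM => //; apply/ideal_classE/ideal_class_repr.
Qed.

Lemma class_addA : associative class_add.
Proof.
move=> D E G; rewrite -(ideal_class_repr D) -(ideal_class_repr E).
rewrite -(ideal_class_repr G) !ideal_class_add; apply/ideal_classE => /=.
rewrite ideal_mulA; exact: ideal_equiv_refl.
Qed.

Lemma class_addC : commutative class_add.
Proof.
move=> D E; apply/ideal_classE => /=; rewrite ideal_mulC.
exact: ideal_equiv_refl.
Qed.

Lemma class_add0 : left_id class0 class_add.
Proof.
move=> D; rewrite -(ideal_class_repr D) ideal_class_add.
apply/ideal_classE => /=; rewrite ideal_mulT; first exact: ideal_equiv_refl.
exact: (invertible_ideal_ideal (repr D)).
Qed.

Lemma class_addN : left_inverse class0 class_opp class_add.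
Proof.
move=> D; rewrite class_addC -{1}(ideal_class_repr D) ideal_class_add.
apply/ideal_classE => /=; have [a [ra ->]] := inv_invertibleP (repr D).
exists 1, a; split=> //; first exact: lreg1.
by rewrite ideal_scaleM mul1r.
Qed.

HB.instance Definition _ :=
  GRing.isZmodule.Build class_group class_addA class_addC class_add0 class_addN.

End ClassGroup.

(* Only invertible ideals have a class. *)
Definition has_class (R : comNzRingType) (I : set R) (D : class_group R) :=
  exists2 J : invertible_ideal R, val J = I & ideal_class J = D.

Section Curve.
Variable k : fieldType.
Implicit Types F u v : {poly k}.

(* k[x][y] / (y^2 - F(x)): the outer variable is y, the inner one is x. *)
Definition coord_ring F := {poly %/ ('X^2 - F%:P : {poly {poly k}})}.

Definition curve_x F u : coord_ring F := in_qpoly _ u%:P.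
Definition curve_y F : coord_ring F := in_qpoly _ 'X.

Definition mumford_ideal F u v : set (coord_ring F) :=
  ideal_gen [set curve_x F u; curve_y F - curve_x F v].

(* The multiple roots of F lie in an algebraic closure of k, so the last clause
   ranges over the finite extensions of k. *)
Definition mumford_pair F u v :=
  [/\ (size v < size u)%N,
      u %| v ^+ 2 - F &
      forall (L : fieldExtType k) (a : L),
        let ext (q : {poly k}) := map_poly (in_alg L) q in
        ('X - a%:P) ^+ 2 %| ext F ->
        'X - a%:P %| ext u -> 'X - a%:P %| ext v ->
        ~~ ('X - a%:P %| ext ((F - v ^+ 2) %/ u))].

(* For F of odd degree the affine curve misses a single, smooth point, so this
   is the group of rational points of the generalized Jacobian. *)
Definition Jac F : zmodType := class_group (coord_ring F).

Definition mumford_represents F u v (D : Jac F) :=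
  mumford_pair F u v /\ @has_class (coord_ring F) (mumford_ideal u v) D.

End Curve.

Arguments mumford_ideal {k} F u v _.
Arguments mumford_represents {k} F u v D.

(* y^2 = x f(x)^2 *)
Definition nodal_poly (k : fieldType) (f : {poly k}) : {poly k} := 'X * f ^+ 2.

Lemma curve_eq (k : fieldType) (F : {poly k}) :
  curve_y F ^+ 2 = curve_x F F.
Proof.
apply/eqP; rewrite -subr_eq0 /curve_y /curve_x -rmorphXn -rmorphB /=.
set h := _ - _; have hmon : h \is monic by exact: monicXnsubC.
have hm : mk_monic h = h by rewrite /mk_monic size_XnsubC // hmon.
by apply/eqP/val_inj; rewrite /= hm; exact: Pdiv.RingMonic.rmodpp.
Qed.

Lemma mumford_represents0 (k : fieldType) (F : {poly k}) :
  mumford_represents F 1 0 0.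
Proof.
split.
  split=> [||L a ext _]; rewrite ?size_poly0 ?size_poly1 ?dvd1p //.
  rewrite /ext rmorph1 => /dvdp_leq; rewrite oner_eq0 size_XsubC size_poly1.
  by move=> /(_ isT).
exists (InvertibleIdeal invertible_idealT) => //=.
have [_ _ hM] := ideal_gen_ideal [set curve_x F 1; curve_y F - curve_x F 0].
apply/seteqP; split=> // z _; rewrite -[z]mulr1; apply: hM.
apply: sub_gen_smallest; left.
by rewrite /curve_x polyC1 in_qpoly1.
Qed.

Lemma mumford_represents_inj (k : fieldType) (F u v : {poly k}) (D E : Jac F) :
  mumford_represents F u v D -> mumford_represents F u v E -> D = E.
Proof.
move=> [_ [I eI <-]] [_ [J eJ <-]]; congr ideal_class.
by apply/val_inj; rewrite eI eJ.
Qed.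

(* Main.v *)
(* The substitution x = t^2, y = t f(t^2) embeds the coordinate ring R of the
   curve into B = k[t]. With A = k[t^2], the image is A + f(t^2) B, so f(t^2) B is
   the conductor. For an invertible ideal I of R, the ideal I B is principal,
   say m B, and I / m contains the conductor and generates B. Hence I / m is
   determined by a nonzero subspace of the plane B / f(t^2) B over the field
   k[x] / (f). The whole plane is excluded because R <> B, and the line through
   1 gives R itself. Any other line passes through t - h for exactly one h of
   degree < d. It generates B if and only if x - h^2 is invertible modulo f, and
   f(t^2) times this module is the ideal (f^2, y - h f). Since the units of B
   are constants, the class of I determines the line. *)
Require Import Defs.
From HB Require Import structures.
From mathcomp Require Import all_boot all_order all_algebra all_field.
From mathcomp Require Import boolp classical_sets ring.
Import GRing.Theory.
Set Implicit Arguments.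
Unset Strict Implicit.
Local Open Scope ring_scope.
Local Open Scope classical_set_scope.

(** * Even and odd parts: [k[t]] as a free module over [k[t^2]] *)

Section SquareSubstitution.
Variable k : fieldType.
Implicit Types (a b : {poly k}).

Definition sq a : {poly k} := a \Po 'X^2.
HB.instance Definition _ := GRing.RMorphism.copy sq (comp_poly 'X^2).

Lemma sqX : sq 'X = 'X ^+ 2.
Proof. exact: comp_polyX. Qed.

Lemma sqC c : sq c%:P = c%:P.
Proof. exact: comp_polyC. Qed.

(** Coordinates in the basis [1], [t] over [k[t^2]]: the variable stands for [x = t^2] in the
    arguments and for [t] in the value. *)
Definition lift a b : {poly k} := sq a + sq b * 'X.

Lemma liftK1 a b : even_poly (lift a b) = a.
Proof.
apply/polyP => i; rewrite coef_even_poly /lift /sq coefD coefMX.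
rewrite !coef_comp_poly_Xn // dvdn2 odd_double /= divn2 doubleK.
case: i => [|i] /=; first by rewrite addr0.
by rewrite dvdn2 /= odd_double addr0.
Qed.

Lemma liftK2 a b : odd_poly (lift a b) = b.
Proof.
apply/polyP => i; rewrite coef_odd_poly /lift /sq coefD coefMX /=.
by rewrite !coef_comp_poly_Xn // !dvdn2 /= odd_double /= divn2 doubleK add0r.
Qed.

Lemma lift_inj a b a' b' : lift a b = lift a' b' -> a = a' /\ b = b'.
Proof.
by move=> e; split; [rewrite -(liftK1 a b)|rewrite -(liftK2 a b)];
  rewrite e ?liftK1 ?liftK2.
Qed.

Lemma lift_surj (P : {poly k}) : exists a b, P = lift a b.
Proof. by exists (even_poly P), (odd_poly P); rewrite /lift /sq poly_even_odd. Qed.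

Lemma liftD a b c d : lift a b + lift c d = lift (a + c) (b + d).
Proof. by rewrite /lift !rmorphD /=; ring. Qed.

Lemma liftN a b : - lift a b = lift (- a) (- b).
Proof. by rewrite /lift !rmorphN /=; ring. Qed.

Lemma liftM a b c d :
  lift a b * lift c d = lift (a * c + 'X * (b * d)) (a * d + b * c).
Proof. by rewrite /lift !(rmorphD, rmorphM) /= sqX; ring. Qed.

Lemma lift_sq a : sq a = lift a 0.
Proof. by rewrite /lift rmorph0 mul0r addr0. Qed.

Lemma liftX : 'X = lift 0 1.
Proof. by rewrite /lift rmorph0 rmorph1 mul1r add0r. Qed.

Lemma lift1 : 1 = lift 1 0.
Proof. by rewrite -lift_sq rmorph1. Qed.

Lemma sq_eq0 a : (sq a == 0) = (a == 0).
Proof.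
apply/eqP/eqP => [e|->]; last exact: rmorph0.
have /lift_inj[] // : lift a 0 = lift 0 0.
by rewrite -!lift_sq e rmorph0.
Qed.

End SquareSubstitution.

(** Euclidean division by a nonzero element of least size; the zero ideal takes [m = 0]. *)
Lemma poly_ideal_principal (k : fieldType) (S : set {poly k}) :
  is_ideal S -> exists m, S = ideal_scale m setT.
Proof.
move=> [S0 SD SM].
have [[P [SP P0]]|nP] := pselect (exists P, S P /\ P != 0); last first.
  exists 0; apply/seteqP; split=> [s Ss|_ [q _ <-]]; last by rewrite mul0r.
  exists 0 => //; rewrite mul0r; apply/eqP; rewrite eq_sym; apply/negPn/negP => s0.
  by apply: nP; exists s.
pose Q n := `[< exists P, [/\ S P, P != 0 & size P = n] >].
have exQ : exists n, Q n by exists (size P); apply/asboolP; exists P.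
case: (ex_minnP exQ) => n /asboolP[m [Sm m0 sm]] minm.
exists m; apply/seteqP; split=> [s Ss|_ [q _ <-]]; last by rewrite mulrC; exact: SM.
exists (s %/ m) => //; rewrite mulrC [RHS](divp_eq s m).
suff /eqP-> : s %% m == 0 by rewrite addr0.
apply/negPn/negP => r0.
have : Q (size (s %% m)).
  apply/asboolP; exists (s %% m); split=> //.
  have -> : s %% m = s + - (s %/ m) * m.
    by rewrite {2}(divp_eq s m) mulNr addrAC subrr add0r.
  by apply: SD => //; apply: SM.
by move/minm; rewrite -sm leqNgt ltn_modp m0.
Qed.

(** * The parametrization [x = t^2], [y = t f(t^2)] of the nodal curve *)

Section NodalRing.
Variables (k : fieldType) (f : {poly k}).
Local Notation N := (nodal_poly f).
Local Notation R := (coord_ring N).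

Definition param_eval (P : {poly {poly k}}) : {poly k} :=
  horner_eval ('X * sq f) (map_poly (@sq k) P).
HB.instance Definition _ := GRing.RMorphism.copy param_eval
  (horner_eval ('X * sq f) \o map_poly (@sq k)).

Lemma param_evalC a : param_eval a%:P = sq a.
Proof. by rewrite /param_eval map_polyC /horner_eval hornerC. Qed.

Lemma param_evalX : param_eval 'X = 'X * sq f.
Proof. by rewrite /param_eval map_polyX /horner_eval hornerX. Qed.

Lemma mk_monic_curve : mk_monic ('X^2 - N%:P) = 'X^2 - N%:P.
Proof. by rewrite /mk_monic size_XnsubC // monicXnsubC. Qed.

Definition param (z : R) : {poly k} := param_eval (val z).

(** Reduction modulo the curve equation is invisible, since [(t f(t^2))^2 = t^2 f(t^2)^2]. *)
Lemma param_in_qpoly P : param (in_qpoly _ P) = param_eval P.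
Proof.
rewrite /param /= mk_monic_curve.
have h : 'X^2 - N%:P \is monic by exact: monicXnsubC.
have h0 : param_eval ('X^2 - N%:P) = 0.
  rewrite rmorphB rmorphXn /= param_evalX param_evalC.
  by rewrite /nodal_poly rmorphM rmorphXn /= sqX exprMn subrr.
move: ('X^2 - N%:P) h h0 => m hm m0.
by rewrite [in RHS](Pdiv.RingMonic.rdivp_eq hm P) rmorphD rmorphM /= m0 mulr0 add0r.
Qed.

Lemma in_qpoly_val (z : R) : z = in_qpoly _ (val z).
Proof.
exact/val_inj/esym/in_qpoly_small/size_mk_monic.
Qed.


Lemma paramD z w : param (z + w) = param z + param w.
Proof. exact: (rmorphD param_eval). Qed.

Lemma paramN z : param (- z) = - param z.
Proof. exact: (rmorphN param_eval). Qed.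

Lemma paramM z w : param (z * w) = param z * param w.
Proof.
rewrite {1}(in_qpoly_val z) {1}(in_qpoly_val w) -rmorphM.
by rewrite param_in_qpoly rmorphM.
Qed.

Lemma param_curve_x a : param (curve_x N a) = lift a 0.
Proof. by rewrite param_in_qpoly param_evalC lift_sq. Qed.

Lemma param_curve_y : param (curve_y N) = lift 0 f.
Proof. by rewrite param_in_qpoly param_evalX /lift rmorph0 add0r mulrC. Qed.

Lemma coord_ring_basis (z : R) :
  exists a b, z = curve_x N a + curve_x N b * curve_y N.
Proof.
exists (val z)`_0, (val z)`_1.
rewrite -rmorphM -rmorphD {1}(in_qpoly_val z); congr in_qpoly.
have sz : (size (val z) <= 2)%N.
  by rewrite -ltnS (leq_trans (size_mk_monic z)) // mk_monic_curve size_XnsubC.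
apply/polyP => i; rewrite coefD coefC coefMX coefC.
case: i => [|[|i]] /=; rewrite ?addr0 ?add0r //.
by rewrite nth_default // (leq_trans sz).
Qed.

Lemma param_basis a b :
  param (curve_x N a + curve_x N b * curve_y N) = lift a (b * f).
Proof.
rewrite paramD paramM !param_curve_x param_curve_y liftM liftD.
by congr lift; ring.
Qed.

Hypothesis f0 : f != 0.

(** Even and odd parts recover [a] and [b f] from the image of [a + b y], and [f] cancels. *)
Lemma param_inj : injective param.
Proof.
move=> z w; have [a [b ->]] := coord_ring_basis z.
have [c [d ->]] := coord_ring_basis w; rewrite !param_basis.
by move=> /lift_inj[-> /(mulIf f0) ->].
Qed.

Lemma param0 : param 0 = 0.
Proof. exact: (rmorph0 param_eval). Qed.

Lemma param_eq0 z : (param z == 0) = (z == 0).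
Proof. by rewrite -[X in _ == X]param0 (inj_eq param_inj). Qed.

Lemma lreg_paramP z : GRing.lreg z <-> param z != 0.
Proof.
split=> [/lreg_neq0|z0]; first by rewrite param_eq0.
by move=> u v /(congr1 param); rewrite !paramM => /(mulfI z0) /param_inj.
Qed.

Lemma param_conductor P : exists z, param z = sq f * P.
Proof.
have [a [b ->]] := lift_surj P.
exists (curve_x N (f * a) + curve_x N b * curve_y N).
by rewrite param_basis lift_sq liftM; congr lift; ring.
Qed.

Lemma param_image_scale a (I : set R) :
  param @` ideal_scale a I = ideal_scale (param a) (param @` I).
Proof.
apply/seteqP; split=> [_ [_ [z Iz <-] <-]|_ [_ [z Iz <-] <-]].
  by exists (param z); [exists z|rewrite paramM].
by exists (a * z); [exists z|rewrite paramM].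
Qed.

(** The scalars [P] and [Q] need not come from the ring, but multiplying both by [f(t^2)] moves them
    into its image. *)
Lemma ideal_equiv_param (I J : set R) : ideal_equiv I J <->
  exists P Q, [/\ P != 0, Q != 0 &
    ideal_scale P (param @` I) = ideal_scale Q (param @` J)].
Proof.
split=> [[a [b [/lreg_paramP ra /lreg_paramP rb e]]]|[P [Q [P0 Q0 e]]]].
  by exists (param a), (param b); rewrite -!param_image_scale e.
have [a ea] := param_conductor P; have [b eb] := param_conductor Q.
exists a, b; split; try by apply/lreg_paramP; rewrite ?ea ?eb mulf_neq0 ?sq_eq0.
have sub (K L : set R) : param @` K = param @` L -> K `<=` L.
  move=> eKL z Kz; have [w Lw /param_inj<-//] : (param @` L) (param z).
  by rewrite -eKL; exists z.
have {}e : param @` ideal_scale a I = param @` ideal_scale b J.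
  by rewrite !param_image_scale ea eb -!ideal_scaleM e.
by apply/seteqP; split; apply: sub.
Qed.

(** * Images in [k[t]] of the ring and of the Mumford ideals *)

Definition nodal_ring : set {poly k} := [set P | exists a b, P = lift a (f * b)].

Lemma param_setT : param @` setT = nodal_ring.
Proof.
apply/seteqP; split=> [_ [z _ <-]|_ [a [b ->]]].
  have [a [b ->]] := coord_ring_basis z; exists a, b.
  by rewrite param_basis mulrC.
exists (curve_x N a + curve_x N b * curve_y N) => //.
by rewrite param_basis mulrC.
Qed.

(* [f(t^2) k[t] + A (t - h)], where [A = k[t^2]] *)
Definition line h : set {poly k} :=
  [set P | exists b c, P = lift (f * c - h * b) b].

(** The generators map to [f(t^2)] times [f(t^2)] and [f(t^2)] times [t - h(t^2)]; the second
    factors generate [line h] over the image of the ring. *)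
Lemma param_mumford_ideal h :
  param @` mumford_ideal N (f ^+ 2) (h * f) = ideal_scale (sq f) (line h).
Proof.
pose M := [set z : R | ideal_scale (sq f) (line h) (param z)].
have hM : is_ideal M.
  rewrite /M; split=> [|z w [_ [b [c ->]] ez] [_ [b' [c' ->]] ew]|z w [_ [b [c ->]] ew]] /=.
  - exists 0; last by rewrite param0 mulr0.
    by exists 0, 0; rewrite !mulr0 subr0 /lift !rmorph0 mul0r addr0.
  - exists (lift (f * (c + c') - h * (b + b')) (b + b')).
      by exists (b + b'), (c + c').
    by rewrite paramD -ez -ew -mulrDr liftD; congr (_ * lift _ _); ring.
  - have [a [d ->]] := coord_ring_basis z.
    (* [b1] is the odd part of the product, and [c1] is solved from its even part. *)
    pose b1 := a * b + d * f * (f * c - h * b).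
    pose c1 := a * c + 'X * d * b + d * h * (f * c - h * b).
    exists (lift (f * c1 - h * b1) b1); first by exists b1, c1.
    rewrite paramM param_basis -ew lift_sq !liftM /b1 /c1.
    by congr lift; ring.
apply/seteqP; split=> [_ [z Iz <-]|_ [_ [b [c ->]] <-]].
  suff : mumford_ideal N (f ^+ 2) (h * f) `<=` M by apply.
  apply: smallest_sub => // _ [->|->]; rewrite /M /=.
    exists (lift (f * 1 - h * 0) 0); first by exists 0, 1.
    by rewrite param_curve_x lift_sq liftM; congr lift; ring.
  exists (lift (f * 0 - h * 1) 1); first by exists 1, 0.
  rewrite paramD paramN param_curve_y param_curve_x.
  by rewrite lift_sq liftM liftN liftD; congr lift; ring.
have [I0 ID IM] := ideal_gen_ideal [set curve_x N (f ^+ 2); curve_y N - curve_x N (h * f)].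
exists (curve_x N c * curve_x N (f ^+ 2) +
        curve_x N b * (curve_y N - curve_x N (h * f))).
  by apply: ID; apply: IM; apply: sub_gen_smallest; [left|right].
rewrite paramD !paramM paramD paramN param_curve_y !param_curve_x.
by rewrite lift_sq liftN !(liftM, liftD); congr lift; ring.
Qed.


(** * Lines modulo the conductor, normalized by spanning [k[t]] *)

Hypothesis hf : irreducible_poly f.

(* Since [k[t] = A + t A], for an [A]-module [S] this says [S k[t] = k[t]].  *)
Definition spans (S : set {poly k}) :=
  exists s1 s2, [/\ S s1, S s2 & s1 + 'X * s2 = 1].

Lemma spans_nodal_ring : spans nodal_ring.
Proof.
exists (lift 1 (f * 0)), (lift 0 (f * 0)); split; [by exists 1, 0|by exists 0, 0|].
by rewrite mulr0 -lift1 -lift_sq rmorph0 mulr0 addr0.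
Qed.

(** Eliminating [b] through the odd part of [s1 + t s2 = 1] turns the even part into a Bezout
    relation between [f] and [x - h^2]. *)
Lemma spans_line h : spans (line h) <-> coprimep f ('X - h ^+ 2).
Proof.
split.
  move=> [_ [_ [[b [c ->]] [b' [c' ->]] e]]].
  rewrite liftX liftM liftD [RHS]lift1 in e; have [e1 e2] := lift_inj e.
  apply/Bezout_eq1_coprimepP; exists (c + h * c', b') => /=.
  rewrite -[RHS]e1; have -> : b = h * b' - f * c'.
    by apply/eqP; rewrite -subr_eq0 -e2; apply/eqP; ring.
  by ring.
move=> /Bezout_eq1_coprimepP[[u v] /= e].
exists (lift (f * u - h * (h * v)) (h * v)), (lift (f * 0 - h * v) v).
split; [by exists (h * v), u|by exists v, 0|].
rewrite liftX liftM liftD [RHS]lift1 -[1 in RHS]e.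
by congr lift; ring.
Qed.

(** [P = P s1 + t P s2], where [P s1] and [P s2] are multiples of [Q]. *)
Lemma spans_dvdp S T P Q :
  ideal_scale P S = ideal_scale Q T -> spans S -> Q %| P.
Proof.
move=> e [s1 [s2 [S1 S2 e1]]]; rewrite -[P]mulr1 -e1 mulrDr mulrCA.
have QS s : S s -> Q %| P * s.
  move=> Ss; have [t _ <-] : ideal_scale Q T (P * s) by rewrite -e; exists s.
  exact: dvdp_mulIl.
by apply: dvdp_add; [exact: QS|exact/dvdp_mull/QS].
Qed.

(** [P] and [Q] divide each other, so they differ by a constant, which [T] absorbs. Thus scalars in
    an ideal equivalence cannot move a spanning module. *)
Lemma spans_scale_sub S T P Q : Q != 0 ->
    ideal_scale P S = ideal_scale Q T -> spans S -> spans T ->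
  (forall c s, T s -> T (c%:P * s)) -> S `<=` T.
Proof.
move=> Q0 e hS hT TZ s Ss.
have /eqpP[[c d] /= /andP[c0 d0] ecd] : P %= Q.
  by rewrite /eqp (spans_dvdp e hS) (spans_dvdp (esym e) hT).
have [t Tt et] : ideal_scale Q T (P * s) by rewrite -e; exists s.
suff -> : s = (d^-1 * c)%:P * t by exact: TZ.
apply: (mulfI Q0); rewrite mulrCA et !mul_polyC -scalerA [c *: _]scalerAl ecd.
by rewrite -scalerAl scalerA mulVf ?scale1r.
Qed.

Lemma nodal_ringZ (c : k) s : nodal_ring s -> nodal_ring (c%:P * s).
Proof.
move=> [a [b ->]]; exists (c%:P * a), (c%:P * b).
by rewrite -[in LHS]sqC lift_sq liftM; congr lift; ring.
Qed.

Lemma lineZ h (c : k) s : line h s -> line h (c%:P * s).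
Proof.
move=> [a [b ->]]; exists (c%:P * a), (c%:P * b).
by rewrite -[in LHS]sqC lift_sq liftM; congr lift; ring.
Qed.

Lemma line_nodal_ring h : ~ line h `<=` nodal_ring.
Proof.
move=> /(_ (lift (- h) 1)) []; first by exists 1, 0; congr lift; ring.
move=> a [b /lift_inj[_ e]]; case: hf => sf _; move: sf.
have : f %| 1 by rewrite e dvdp_mulr.
by rewrite dvdp1 => /eqP->.
Qed.

(** [t - h] lies in [line h'] only if [f] divides [h' - h], which then vanishes by degree. *)
Lemma line_inj (h h' : {poly k}) : (size h < size f)%N -> (size h' < size f)%N ->
  line h `<=` line h' -> h = h'.
Proof.
move=> sh sh' /(_ (lift (- h) 1)) []; first by exists 1, 0; congr lift; ring.
move=> b [c /lift_inj[e1 e2]].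
have e : h' - h = f * c by rewrite e1 -e2; ring.
apply/esym/eqP; rewrite -subr_eq0; apply/negPn/negP => n0.
have : (size f <= size (h' - h)%R)%N by rewrite dvdp_leq // e dvdp_mulr.
by rewrite leqNgt (leq_ltn_trans (size_polyD _ _)) // size_polyN gtn_max sh sh'.
Qed.

(* Such a [T] is determined by a subspace of the plane [k[t] / f(t^2) k[t]] over
   the field [k[x] / (f)].  *)
Lemma conductor_module_cases (T : set {poly k}) :
    (forall s t, T s -> T t -> T (s + t)) ->
    (forall a s, T s -> T (sq a * s)) ->
    (forall P, T (sq f * P)) -> spans T ->
  [\/ T = nodal_ring,
      exists h : {poly k}, [/\ (size h < size f)%N, coprimep f ('X - h ^+ 2) & T = line h] |
      T = setT].
Proof.
move=> TD TM Tf sT.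
have cop a : ~~ (f %| a) -> coprimep f a by rewrite irreducible_poly_coprime.
(* Scaling by an inverse of [b] modulo [f] makes the odd part [1], up to the conductor. *)
have unitT a b : ~~ (f %| b) -> T (lift a b) -> exists c, T (lift c 1).
  move=> /cop /Bezout_eq1_coprimepP[[u v] /= e] Tab; exists (v * a).
  have -> : lift (v * a) 1 = sq v * lift a b + sq f * lift 0 u.
    by rewrite -e !lift_sq !(liftM, liftD); congr lift; ring.
  by apply: TD => //; apply: TM.
have unitT0 a : ~~ (f %| a) -> T (lift a 0) -> T 1.
  move=> /cop /Bezout_eq1_coprimepP[[u v] /= e] Ta.
  have -> : 1 = sq v * lift a 0 + sq f * lift u 0.
    by rewrite [LHS]lift1 -e !lift_sq !(liftM, liftD); congr lift; ring.
  by apply: TD => //; apply: TM.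
(* If every odd part vanishes modulo [f], then [T] is the line through [1]. *)
have [[a0 [b0 [nb0 /(unitT _ _ nb0)[a Ta]]]]|odd_dvd] :=
    pselect (exists a b, ~~ (f %| b) /\ T (lift a b)); last first.
  have {}odd_dvd a b : T (lift a b) -> f %| b.
    by move=> Tab; apply/negPn/negP => nb; apply: odd_dvd; exists a, b.
  suff T1 : T 1.
    constructor 1; apply/seteqP; split=> [s|_ [a [b ->]]].
      have [a [b ->]] := lift_surj s; move=> /odd_dvd /dvdpP[q ->].
      by exists a, q; rewrite mulrC.
    have -> : lift a (f * b) = sq a * 1 + sq f * lift 0 b.
      by rewrite mulr1 !lift_sq !(liftM, liftD); congr lift; ring.
    by apply: TD => //; apply: TM.
  have [s1 [s2 []]] := sT.
  have [a [b ->]] := lift_surj s1; have [a' [b' ->]] := lift_surj s2.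
  move=> Tab /odd_dvd /dvdpP[q' ->].
  have /dvdpP[q eb] := odd_dvd _ _ Tab.
  (* With odd parts divisible by [f], the even part of the spanning relation makes [a] a unit modulo
     [f]. *)
  rewrite liftX liftM liftD [RHS]lift1 => /lift_inj[e _].
  apply: (unitT0 a).
    rewrite -irreducible_poly_coprime //; apply/Bezout_eq1_coprimepP.
    by exists ('X * q', 1) => /=; rewrite -[RHS]e; ring.
  have -> : lift a 0 = lift a b + sq f * lift 0 (- q).
    by rewrite eb lift_sq liftM liftD; congr lift; ring.
  exact: TD.
(* Modulo the conductor, [t + a] becomes [t - h] with [h] reduced modulo [f]. *)
pose q := (- a) %/ f; pose h := (- a) %% f.
have ea : - a = q * f + h by exact: divp_eq.
have Th : T (lift (- h) 1).
  have -> : lift (- h) 1 = lift a 1 + sq f * lift q 0.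
    rewrite -[a]opprK ea lift_sq liftM liftD; congr lift; ring.
  exact: TD.
(* [lift c e] is [e (t - h) + (c + h e)], all coefficients taken at [t^2]. If [c + h e] is a unit
   modulo [f], then [1] joins [t - h] in [T], and [T] is everything. *)
have [[c [e [nce Tce]]]|line_dvd] :=
    pselect (exists c e, ~~ (f %| c + h * e) /\ T (lift c e)).
  constructor 3; apply/seteqP; split=> // s _.
  have T1 : T 1.
    apply: (unitT0 _ nce).
    have -> : lift (c + h * e) 0 = lift c e + sq (- e) * lift (- h) 1.
      by rewrite lift_sq liftM liftD; congr lift; ring.
    by apply: TD => //; apply: TM.
  have [u [v ->]] := lift_surj s.
  have -> : lift u v = sq (u + v * h) * 1 + sq v * lift (- h) 1.
    by rewrite mulr1 !lift_sq liftM liftD; congr lift; ring.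
  by apply: TD; apply: TM.
have eT : T = line h.
  apply/seteqP; split=> [s|_ [b [c ->]]].
    have [c [e ->]] := lift_surj s => Tce; exists e.
    have /dvdpP[r er] : f %| c + h * e.
      by apply/negPn/negP => nce; apply: line_dvd; exists c, e.
    by exists r; congr lift; rewrite mulrC -er; ring.
  have -> : lift (f * c - h * b) b = sq b * lift (- h) 1 + sq f * lift c 0.
    by rewrite !lift_sq !liftM liftD; congr lift; ring.
  by apply: TD => //; apply: TM.
constructor 2; exists h; split=> //; first by rewrite ltn_modp.
by apply/spans_line; rewrite -eT.
Qed.

(** * Invertible ideals of the nodal ring *)

Lemma param_invertible_ideal (I : set R) : is_invertible_ideal I ->
  exists2 m, m != 0 & param @` I = ideal_scale m nodal_ring \/
    exists h : {poly k}, [/\ (size h < size f)%N, coprimep f ('X - h ^+ 2) &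
                  param @` I = ideal_scale m (line h)].
Proof.
move=> [hI [J [a [hJ /lreg_paramP ra eIJ]]]]; have [I0 ID IM] := hI.
(* [S] is the extension of [I] to [k[t] = A + t A], where [A = k[t^2]]. *)
pose S := [set P | exists i j, [/\ I i, I j & P = param i + 'X * param j]].
have hS : is_ideal S.
  split=> [|_ _ [i [j [Ii Ij ->]]] [i' [j' [Ii' Ij' ->]]]|P _ [i [j [Ii Ij ->]]]].
  - by exists 0, 0; rewrite param0 mulr0 addr0.
  - exists (i + i'), (j + j'); split; [exact: ID|exact: ID|].
    by rewrite !paramD; ring.
  - have [u [v ->]] := lift_surj P.
    exists (curve_x N u * i + curve_x N ('X * v) * j),
      (curve_x N u * j + curve_x N v * i).
    split; [by apply: ID; apply: IM|by apply: ID; apply: IM|].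
    rewrite !paramD !paramM !param_curve_x -!lift_sq /lift rmorphM /= sqX.
    by ring.
have [m eS] := poly_ideal_principal hS.
have SI i : I i -> S (param i).
  by move=> Ii; exists i, 0; rewrite param0 mulr0 addr0.
(* The regular element [a] lies in [I J], hence in [I]; this rules out [m = 0]. *)
have aIJ : ideal_mul I J a by rewrite eIJ; exists 1; rewrite ?mulr1.
have m0 : m != 0.
  apply: contraNneq ra => m0.
  have /SI : I a.
    have sub : ideal_mul I J `<=` I.
      by apply/ideal_mul_sub => // x y Ix _; rewrite mulrC; exact: IM.
    exact: sub.
  by rewrite eS => -[q _ <-]; rewrite m0 mul0r.
pose T := [set s | exists2 i, I i & param i = m * s].
have eT : param @` I = ideal_scale m T.
  apply/seteqP; split=> [_ [i Ii <-]|_ [s [i Ii ei] <-]]; last by exists i.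
  have := SI _ Ii; rewrite eS => -[s _ es].
  by exists s => //; exists i.
have [i [j [Ii Ij emij]]] : S m by rewrite eS; exists 1; rewrite ?mulr1.
have [||||eqT|[h [sh ch eqT]]|eqT] := @conductor_module_cases T.
- move=> s t [u Iu eu] [v Iv ev]; exists (u + v); first exact: ID.
  by rewrite paramD eu ev mulrDr.
- move=> c s [u Iu eu]; exists (curve_x N c * u); first exact: IM.
  by rewrite paramM eu param_curve_x lift_sq mulrCA.
(* As [m = i + t j] in [k[t]], the coefficients needed are [f(t^2) P] and [f(t^2) t P], both images
   of ring elements. *)
- move=> P; have [z ez] := param_conductor P.
  have [w ew] := param_conductor ('X * P).
  exists (z * i + w * j); first by apply: ID; apply: IM.
  by rewrite paramD !paramM ez ew {1}emij; ring.
- have TI u : I u -> exists2 s, T s & m * s = param u.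
    move=> Iu; have [s Ts es] : ideal_scale m T (param u) by rewrite -eT; exists u.
    by exists s.
  have [s Ts es] := TI _ Ii; have [t Tt et] := TI _ Ij.
  exists s, t; split=> //; apply: (mulfI m0).
  by rewrite mulr1 [RHS]emij -es -et; ring.
- by exists m => //; left; rewrite eT eqT.
- by exists m => //; right; exists h; rewrite eT eqT.
exfalso.
(* Now [I], hence [I J = a R], is stable under multiplication by [t]. *)
pose L := [set z | exists2 w, ideal_mul I J w & param w = 'X * param z].
have [IJ0 IJD IJM] := ideal_gen_ideal [set x * y | x in I & y in J].
have hL : is_ideal L.
  split=> [|z z' [w Iw ew] [w' Iw' ew']|c z [w Iw ew]].
  - by exists 0 => //; rewrite param0 mulr0.
  - by exists (w + w'); [exact: IJD|rewrite !paramD ew ew' mulrDr].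
  - by exists (c * w); [exact: IJM|rewrite !paramM ew mulrCA].
have sub : ideal_mul I J `<=` L.
  apply/ideal_mul_sub => // u v Iu Jv.
  have [_ [s _ <-] es] : exists2 P, ideal_scale m T P & P = param u.
    by exists (param u) => //; rewrite -eT; exists u.
  have [w Iw ew] : T ('X * s) by rewrite eqT.
  exists (w * v); first exact: ideal_mul_mem.
  by rewrite !paramM ew -es; ring.
have [w] := sub _ aIJ; rewrite eIJ => -[z _ <-].
rewrite paramM mulrC => /(mulIf ra) ez.
apply: (@line_nodal_ring 0) => _ [b [c ->]].
have : nodal_ring (param z) by rewrite -param_setT; exists z.
rewrite ez liftX => -[u [v /lift_inj[_ e]]].
by exists (f * c - 0 * b), (v * b); rewrite mulrA -e mul1r.
Qed.

(** The inverse comes from the conjugate ideal, with [-h] for [h]: the product is the principal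
    ideal of [f^2]. *)
Lemma mumford_ideal_invertible h : coprimep f ('X - h ^+ 2) ->
  is_invertible_ideal (mumford_ideal N (f ^+ 2) (h * f)).
Proof.
move=> ch; split; first exact: ideal_gen_ideal.
set I := mumford_ideal _ _ _; pose J := mumford_ideal N (f ^+ 2) (- h * f).
pose a := curve_x N (f ^+ 2).
exists J, a; split; first exact: ideal_gen_ideal.
  by apply/lreg_paramP; rewrite param_curve_x -lift_sq sq_eq0 expf_neq0.
have [IJ0 IJD IJM] := ideal_gen_ideal [set x * y | x in I & y in J].
apply/seteqP; split.
  apply/ideal_mul_sub => [|x y Ix Jy]; first exact/ideal_scale_ideal/setT_ideal.
  have : (param @` I) (param x) by exists x.
  have : (param @` J) (param y) by exists y.
  rewrite !param_mumford_ideal => -[_ [b [c ->]] ey] [_ [b' [c' ->]] ex].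
  have [z _ ez] : (param @` setT) (lift (f * c - - h * b) b * lift (f * c' - h * b') b').
    rewrite param_setT liftM.
    exists ((f * c - - h * b) * (f * c' - h * b') + 'X * (b * b')), (c * b' + b * c').
    by congr lift; ring.
  exists z => //; apply: param_inj; rewrite !paramM ez -ex -ey.
  by rewrite param_curve_x !lift_sq !liftM; congr lift; ring.
move=> _ [z _ <-]; rewrite mulrC; apply: (IJM).
(* Since [y1 y2 = f^2 (x - h^2)], multiplying this Bezout relation by [f^2] writes [a] through [a a]
   and [y1 y2]. *)
have : coprimep (f ^+ 2) ('X - h ^+ 2) by rewrite coprimep_expl.
move=> /Bezout_eq1_coprimepP[[u v] /= e].
pose y1 := curve_y N - curve_x N (h * f).
pose y2 := curve_y N - curve_x N (- h * f).
have -> : a = curve_x N u * (a * a) + curve_x N v * (y1 * y2).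
  apply: param_inj; rewrite !(paramD, paramM, paramN) !param_curve_x param_curve_y.
  rewrite -[f ^+ 2 in LHS]mulr1 -[in LHS]e.
  by rewrite !liftN !(liftM, liftD); congr lift; ring.
by apply: IJD; apply: IJM; apply: ideal_mul_mem; apply: sub_gen_smallest;
  [left|left|right|right].
Qed.

(** The quotient in the third condition is [x - h^2]; its coprimality with [f] survives field
    extension, so it shares no root with [f^2]. *)
Lemma mumford_pair_line (h : {poly k}) :
  (size h < size f)%N -> coprimep f ('X - h ^+ 2) ->
  mumford_pair N (f ^+ 2) (h * f).
Proof.
move=> sh ch; split=> [||L a ext _ du _].
- have [->|h0] := eqVneq h 0; first by rewrite mul0r size_poly0 size_poly_gt0 expf_neq0.
  rewrite expr2 !size_mul //; case: (size f) sh => // n sh.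
  by rewrite !addnS /= ltn_add2r.
- apply/dvdpP; exists (h ^+ 2 - 'X); rewrite /nodal_poly; ring.
have -> : (N - (h * f) ^+ 2) %/ f ^+ 2 = 'X - h ^+ 2.
  rewrite /nodal_poly; have -> : 'X * f ^+ 2 - (h * f) ^+ 2 = ('X - h ^+ 2) * f ^+ 2 by ring.
  by rewrite mulpK ?expf_neq0.
apply/negP => dv.
have : coprimep (ext (f ^+ 2)) (ext ('X - h ^+ 2)).
  by rewrite coprimep_map coprimep_expl.
move=> /coprimepP/(_ _ du dv); rewrite -size_poly_eq1 size_XsubC.
by [].
Qed.

End NodalRing.

(** The zero class stands apart: its line, the one through [1], contains no [t - h], and its pair is
    [[1, 0]]. *)
Theorem theorem1 (k : finFieldType) (p : nat) (hp : p \in [pchar k])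
    (hp2 : p != 2%N) (f : {poly k}) (d : nat) (hf : irreducible_poly f)
    (hd : size f = d.+1) :
  let N := nodal_poly f in
  let reduced (h : {poly k}) :=
    (size h <= d)%N /\ coprimep f ('X - h ^+ 2) in
  (forall D : Jac N, D <> 0 ->
     exists! h : {poly k},
       reduced h /\ mumford_represents N (f ^+ 2) (h * f) D) /\
  (forall h : {poly k}, reduced h ->
     exists2 D : Jac N, D <> 0 & mumford_represents N (f ^+ 2) (h * f) D).
Proof.
move=> N reduced.
have f0 : f != 0 by rewrite -size_poly_gt0 hd.
have pair h : reduced h -> mumford_pair N (f ^+ 2) (h * f).
  by move=> [sh ch]; apply: mumford_pair_line; rewrite ?hd.
split=> [D D0|h rh].
  pose I := repr D.
  have [m m0 [eI|[h [sh ch eI]]]] := param_invertible_ideal f0 hf (invertible_idealP I).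
    case: D0; rewrite -(ideal_class_repr D); apply/ideal_classE/(ideal_equiv_param f0).
    exists 1, m; split; rewrite ?oner_neq0 //= eI param_setT ideal_scaleM mul1r //.
  have rh : reduced h by rewrite /reduced -ltnS -hd.
  exists h; split.
    split=> //; split; first exact: pair.
    exists (InvertibleIdeal (mumford_ideal_invertible f0 ch)) => //.
    rewrite -(ideal_class_repr D); apply/ideal_classE/(ideal_equiv_param f0).
    exists m, (sq f); rewrite sq_eq0; split=> //=.
    by rewrite param_mumford_ideal // eI !ideal_scaleM mulrC.
  move=> h' [[sh' ch'] [_ [J eJ eD]]].
  have : ideal_class J = ideal_class I by rewrite eD [RHS]ideal_class_repr.
  move=> /ideal_classE/(ideal_equiv_param f0)[P [Q [P0 Q0]]].
  rewrite eJ param_mumford_ideal // eI !ideal_scaleM => e.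
  (* The two lines are proportional and both span [k[t]], so one contains the other. *)
  apply: (@line_inj _ f) => //; first by rewrite hd ltnS.
  apply: (spans_scale_sub _ (esym e)); rewrite ?mulf_neq0 ?sq_eq0 //.
  - exact/spans_line.
  - exact/spans_line.
  - exact: lineZ.
have [sh ch] := rh.
pose I := InvertibleIdeal (mumford_ideal_invertible f0 ch).
exists (ideal_class I); last by split; [exact: pair|exists I].
(* A trivial class would put [line h] inside the image of the ring. *)
move=> /ideal_classE/(ideal_equiv_param f0)[P [Q [P0 Q0]]] /=.
rewrite param_mumford_ideal // param_setT ideal_scaleM => e.
apply: (@line_nodal_ring _ f hf h); apply: (spans_scale_sub _ e) => //.
- exact/spans_line.
- exact: spans_nodal_ring.
- exact: nodal_ringZ.
Qed.
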